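(* Let $X$ be normal with known mean $\mu_X$ and variance $\sigma_X^2>0$, $Y$ normal with known mean $\mu_Y$ and variance $\sigma_Y^2>0$, and $\theta=\sigma_X^2/\sigma_Y^2$. Let $X_1,X_2,\dots$ be i.i.d. samples of $X$ and $Y_1,Y_2,\dots$ i.i.d. samples of $Y$, all mutually independent. Let $m\ge2$ and $\delta_0,\dots,\delta_{m-1}\in(0,1)$. Suppose that $\alpha_i=O(\zeta)\in(0,1)$ and $\beta_i=O(\zeta)\in(0,1)$ for $i=1,\dots,m-1$. Let $2\le n_1^X<n_2^X<\dots<n_s^X$ and $2\le n_1^Y<n_2^Y<\dots<n_s^Y$ be the sample sizes for $X$ and $Y$ respectively. For $\ell=1,\dots,s$ and $i=1,\dots,m-1$ define $$u_{\ell,i}=\max\{1,\Upsilon(n_\ell^X,n_\ell^Y,1-\alpha_i)\},\qquad v_{\ell,i}=\min\{1,\Upsilon(n_\ell^X,n_\ell^Y,\beta_i)\},\qquad\hat\theta_\ell=\frac{n_\ell^Y\sum_{i=1}^{n_\ell^X}(X_i-\mu_X)^2}{n_\ell^X\sum_{i=1}^{n_\ell^Y}(Y_i-\mu_Y)^2}.$$ Suppose that the maximum sample sizes $n_s^X$ and $n_s^Y$ satisfy $\theta_i''v_{s,i}\ge\theta_i'u_{s,i}$ for $i=1,\dots,m-1$. Define $$f_{\ell,i}=\min\left\{\theta_i''v_{\ell,i},\ \tfrac12(\theta_i'u_{\ell,i}+\theta_i''v_{\ell,i})\right\},\qquad g_{\ell,i}=\max\left\{\theta_i'u_{\ell,i},\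 \tfrac12(\theta_i'u_{\ell,i}+\theta_i''v_{\ell,i})\right\}$$ for $i=1,\dots,m-1$ and $\ell=1,\dots,s$, and $$D_\ell=\begin{cases}1&\text{for }\hat\theta_\ell\le f_{\ell,1},\\ i&\text{for }g_{\ell,i-1}<\hat\theta_\ell\le f_{\ell,i}\text{ where }2\le i\le m-1,\\ m&\text{for }\hat\theta_\ell>g_{\ell,m-1},\\0&\text{else}\end{cases}$$ for $\ell=1,\dots,s$. Then $\Pr\{\text{Reject }H_i\mid\theta\}$ is no greater than $\delta_i$ for any $\theta\in\varTheta_i$ and $i=0,1,\dots,m-1$, provided that $\zeta>0$ is sufficiently small.
   Context: Hypotheses on $\theta\in(0,\infty)$: $H_i:\theta\in\Theta_i$, where $\Theta_0=(0,\theta_1]$, $\Theta_{m-1}=(\theta_{m-1},\infty)$, $\Theta_i=(\theta_i,\theta_{i+1}]$ for $1\le i\le m-2$, with $0<\theta_1<\dots<\theta_{m-1}$. $\varTheta_0=(0,\theta_1']$, $\varTheta_{m-1}=[\theta_{m-1}'',\infty)$, $\varTheta_i=[\theta_i'',\theta_{i+1}']$ for $1\le i\le m-2$, where $0<\theta_i'<\theta_i<\theta_i''$ for $1\le i\le m-1$ and $\theta_i''\le\theta_{i+1}'$ for $1\le i\le m-2$. $\Upsilon(d_1,d_2,\alpha)$ denotes the $100\alpha\%$ quantile of the $F$-distribution with $d_1$ and $d_2$ degrees of freedom: $\Pr\{(U/d_1)/(V/d_2)\le\Upsilon(d_1,d_2,\alpha)\}=\alpha$ for independent chi-square variables $U,V$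 of $d_1$ and $d_2$ degrees of freedom. Multistage plan: sampling continues until the first stage $\ell$ with $D_\ell\ne0$; $H_j$ is accepted if then $D_\ell=j+1$; ''Reject $H_i$'' means that some $H_j$ with $j\ne i$ is accepted. $\zeta>0$ is a tuning parameter; $\alpha_i,\beta_i$ are functions of $\zeta$, and $s$ and the sample sizes may depend on $\zeta$. $\delta=O(\zeta)$ means: $\delta$ is a function of $\zeta>0$ for which there are positive constants $A,B$ with $A<\delta/\zeta<B$ for all sufficiently small $\zeta>0$. *)

(* Defs.v *)
From HB Require Import structures.
From mathcomp Require Import all_boot all_order all_algebra.
From mathcomp Require Import all_classical all_reals all_analysis.
From mathcomp Require Import measurable_realfun.

Set Implicit Arguments.
Unset Strict Implicit.
Unset Printing Implicit Defensive.

Import Order.TTheory GRing.Theory Num.Theory.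
Import numFieldNormedType.Exports.

Local Open Scope classical_set_scope.
Local Open Scope ring_scope.

(* The implied constant is required to be two-sided and strictly positive. *)
Definition order_zeta (R : realType) (a : R -> R) : Prop :=
  exists A B : R, [/\ 0 < A, 0 < B & \forall z \near 0^'+, A < a z / z < B].

(* Laws are compared on measurable sets only: the values of a measure on
   other sets carry no meaning.  The second parameter of [normal_prob] is the
   standard deviation. *)
Definition is_normal d (T : measurableType d) (R : realType)
    (P : probability T R) (X : {RV P >-> R}) (mu sigma : R) : Prop :=
  forall V : set R, measurable V -> distribution P X V = normal_prob mu sigma V.

Definition mutually_independent d (T : measurableType d) (R : realType)
    (P : probability T R) (I : eqType) (Z : I -> {RV P >-> R}) : Prop :=
  forall (J : seq I) (B : I -> set R), uniq J ->
    (forall i, measurable (B i)) ->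
    P (\bigcap_(i in [set` J]) (Z i @^-1` B i)) =
    (\prod_(i <- J) P (Z i @^-1` B i))%E.

Definition both_samples (S : Type) (X Y : nat -> S) (k : nat + nat) : S :=
  match k with inl j => X j | inr j => Y j end.

Section F_distribution.
Context {R : realType}.

(* [normal_prob] lives on [measurableTypeR R], the same measurable space as R
   up to its display. *)
Definition add_sqr (p : measurableTypeR R * R) : R := p.1 ^+ 2 + p.2.

Lemma measurable_add_sqr : measurable_fun setT add_sqr.
Proof.
apply: measurable_funD; last exact: measurable_snd.
by apply: measurable_funX; exact: measurable_fst.
Qed.

HB.instance Definition _ :=
  isMeasurableFun.Build _ _ _ _ add_sqr measurable_add_sqr.

(* Law of N_1^2 + ... + N_d^2 for independent standard normal N_1, ..., N_d *)
Fixpoint chi_square_prob (d : nat) : probability R R :=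
  if d is d'.+1 then
    distribution (normal_prob (0 : R) 1 \x chi_square_prob d')%E add_sqr
  else \d_(0 : R).

Definition F_ratio (d1 d2 : nat) (p : R * R) : R :=
  (p.1 / d1%:R) / (p.2 / d2%:R).

(* Pr{(U / d1) / (V / d2) <= x} for independent chi-square variables U, V *)
Definition F_cdf (d1 d2 : nat) (x : R) : \bar R :=
  (chi_square_prob d1 \x chi_square_prob d2)%E
    [set p | F_ratio d1 d2 p <= x].

(* For 0 < a < 1 and d1, d2 > 0 the equation has exactly one solution. *)
Definition F_quantile (d1 d2 : nat) (a : R) : R :=
  xget 0 [set x | F_cdf d1 d2 x = a%:E].

End F_distribution.

(* th1 i and th2 i stand for theta_i' and theta_i''. *)
Definition varTheta (R : realType) (m : nat) (th1 th2 : nat -> R) (i : nat) :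
    set R :=
  if i == 0%N then [set` `]0, th1 1%N]]
  else if i == m.-1 then [set` `[th2 m.-1, +oo[]
  else [set` `[th2 i, th1 i.+1]].

(* The plan for one value of zeta: stages l = 1, ..., s and indices
   i = 1, ..., m-1 are numbered from 1, whereas X j and Y j are the (j+1)-th
   samples. *)
Section plan.
Context {R : realType}.
Variables (m s : nat) (nX nY : nat -> nat) (th1 th2 alpha beta : nat -> R).

Definition u_ (l i : nat) : R :=
  Num.max 1 (F_quantile (nX l) (nY l) (1 - alpha i)).

Definition v_ (l i : nat) : R :=
  Num.min 1 (F_quantile (nX l) (nY l) (beta i)).

Definition f_ (l i : nat) : R :=
  Num.min (th2 i * v_ l i) ((th1 i * u_ l i + th2 i * v_ l i) / 2).

Definition g_ (l i : nat) : R :=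
  Num.max (th1 i * u_ l i) ((th1 i * u_ l i + th2 i * v_ l i) / 2).

(* The middle list ranges over 2 <= i <= m-1.  Since f_ l i <= g_ l i and
   f_ l i <= th2 i <= th1 i.+1 <= g_ l i.+1, the cases exclude each other. *)
Definition decision (l : nat) (x : R) : nat :=
  if x <= f_ l 1 then 1%N
  else if g_ l m.-1 < x then m
  else head 0%N [seq i <- index_iota 2 m | g_ l i.-1 < x <= f_ l i].

Variables (T : Type) (muX muY : R) (X Y : nat -> T -> R).

Definition theta_hat (l : nat) (w : T) : R :=
  ((nY l)%:R * \sum_(j < nX l) (X j w - muX) ^+ 2) /
  ((nX l)%:R * \sum_(j < nY l) (Y j w - muY) ^+ 2).

Definition D_ (l : nat) (w : T) : nat := decision l (theta_hat l w).

Definition accept (j : nat) : set T :=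
  [set w | exists l : nat, [/\ (1 <= l <= s)%N,
     forall k : nat, (1 <= k < l)%N -> D_ k w = 0%N & D_ l w = j.+1]].

Definition reject (i : nat) : set T :=
  \bigcup_(j in [set j : nat | (j < m)%N && (j != i)]) accept j.

End plan.

(* Main.v *)
Require Import Defs.
From mathcomp Require Import all_boot all_order all_algebra.
From mathcomp Require Import all_classical all_reals all_analysis.
From mathcomp Require Import measurable_realfun ring lra zify.

(** The probability of a wrong decision at stage l through the i-th threshold is
at most the probability that an F-distributed variable, with at least l degrees
of freedom in each place, lies in a half-line.  It is at most beta_i (or
alpha_i), hence O(zeta), because the half-line is cut at the corresponding
quantile.  It is also exponentially small in l, uniformly in zeta: either the
other quantile is close to 1, and then the midpoint of theta_i' u and
theta_i'' v keeps the half-line away from 1, so that a Chernoff bound applies;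
or that quantile is far from 1, and then the same Chernoff bound makes alpha_i
(or beta_i) exponentially small, hence also the other one, the ratio of the two
being bounded.  The geometric mean C sqrt(zeta) q^l of the two bounds is
summable over l, so the number of stages, which may grow as zeta tends to 0,
plays no role. *)

Set Implicit Arguments.
Unset Strict Implicit.
Unset Printing Implicit Defensive.

Import Order.TTheory GRing.Theory Num.Theory.
Import numFieldNormedType.Exports.

Local Open Scope classical_set_scope.
Local Open Scope ring_scope.

(** * Measurability of level sets and of pushforwards *)

Section levels.
Context d (T : measurableType d) (R : realType).

Lemma measurable_sublevel (f : T -> R) (x : R) : measurable_fun setT f ->
  measurable [set w | f w <= x].
Proof.
move=> mf; rewrite -[X in measurable X]setTI.
rewrite (_ : [set w | _] = f @^-1` `]-oo, x]); first exact: mf.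
by apply/seteqP; split => w /=; rewrite in_itv/=.
Qed.

Lemma measurable_superlevel (f : T -> R) (x : R) : measurable_fun setT f ->
  measurable [set w | x < f w].
Proof.
move=> mf; rewrite (_ : [set w | _] = ~` [set w | f w <= x]).
  by apply: measurableC; exact: measurable_sublevel.
by apply/seteqP; split => w /=; rewrite ltNge => /negP.
Qed.

End levels.

(** Bundles the image measure as a measure when measurability of the map is only available as a
    proof, so that uniqueness theorems for measures apply to it. *)
Lemma pushforward_is_measure d1 d2 (T1 : measurableType d1)
    (T2 : measurableType d2) (R : realType) (m : {measure set T1 -> \bar R})
    (f : T1 -> T2) : measurable_fun setT f ->
  exists nu : {measure set T2 -> \bar R}, (nu : set T2 -> \bar R) = pushforward m f.
Proof.
by move=> mf; unshelve eexists; [unshelve refine (pushforward m f)|].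
Qed.

(** * Densities and standardization of normal laws *)

Section normal.
Context {R : realType}.
Local Notation leb := (@lebesgue_measure R).

(** The Radon-Nikodym derivative of the normal law and its density have the same integral over every
    measurable set, hence agree almost everywhere. *)
Lemma ge0_integral_normal_prob (m s : R) (f : R -> \bar R) :
  measurable_fun setT f -> (forall x, 0 <= f x)%E ->
  (\int[normal_prob m s]_x f x =
   \int[leb]_x (f x * (normal_pdf m s x)%:E))%E.
Proof.
move=> mf f0.
have dom := normal_prob_dominates m s.
rewrite -(Radon_Nikodym_SigmaFinite.change_of_variables dom f0 measurableT mf).
have mg := measurable_int _ (Radon_Nikodym_SigmaFinite.f_integrable dom).
have mp : measurable_fun setT (fun x => (normal_pdf m s x)%:E).
  by apply/measurable_EFinP; exact: measurable_normal_pdf.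
apply: ae_eq_integral => //.
- exact: emeasurable_funM.
- exact: emeasurable_funM.
- apply: ae_eqe_mul2l => /=; apply: integral_ae_eq => //=.
  + exact: (Radon_Nikodym_SigmaFinite.f_integrable dom).
  + by move=> E _ mE; rewrite -(Radon_Nikodym_SigmaFinite.f_integral dom).
Qed.

Lemma measurable_affine (s m : R) : measurable_fun setT (fun x : R => s * x + m).
Proof. by apply: measurable_funD => //; exact: measurable_funM. Qed.

(** By uniqueness of Lebesgue measure: s times the image measure gives every interval []a, b]] its
    length. *)
Lemma lebesgue_measure_affine (s m : R) (A : set R) : 0 < s -> measurable A ->
  leb A = (s%:E * leb ((fun x => s * x + m)%R @^-1` A))%E.
Proof.
move=> s0 mA; pose F := (fun x => s * x + m) : R -> measurableTypeR R.
have mF : measurable_fun setT F := measurable_affine s m.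
have [nu nuE] := pushforward_is_measure leb mF.
suff -> : leb A = mscale (NngNum (ltW s0)) nu A by rewrite /mscale/= nuE.
apply: lebesgue_measure_unique => // _ [[a b]] _ <-.
transitivity (s%:E * leb (F @^-1` `]a, b]))%E; last first.
  by rewrite -[RHS]/(s%:E * nu _)%E nuE.
have -> : F @^-1` `]a, b] = `](a - m) / s, (b - m) / s]%classic.
  apply/seteqP; split => x /=; rewrite !in_itv/= ltr_pdivrMr// ler_pdivlMr//;
    by rewrite ltrBlDr lerBrDr mulrC.
rewrite !lebesgue_measure_itv/= !lte_fin ltr_pM2r ?invr_gt0// ltrD2r.
case: ifPn => _; last by rewrite mule0.
by rewrite -!EFinB -EFinM; congr EFin; field; rewrite gt_eqF.
Qed.

(** Affine change of variables in the density; the Jacobian 1/s turns the peak of the standard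
    density into that of standard deviation s. *)
Lemma normal_prob_standardize (m s : R) (A : set R) : 0 < s -> measurable A ->
  normal_prob m s ((fun x => s^-1 * (x - m)) @^-1` A) = normal_prob 0 1 A.
Proof.
move=> s0 mA; pose F := (fun x => s^-1 * (x - m)) : R -> measurableTypeR R.
have mF : measurable_fun setT F.
  by apply: measurable_funM => //; exact: measurable_funB.
have sV0 : 0 < s^-1 by rewrite invr_gt0.
have [nu nuE] := pushforward_is_measure leb mF.
rewrite /normal_prob.
transitivity (\int[mscale (NngNum (ltW sV0)) nu]_(x in A)
    (normal_pdf 0 1 x)%:E)%E; last first.
  apply: eq_measure_integral => //= B mB _.
  rewrite (@lebesgue_measure_affine s^-1 (- (s^-1 * m)) B)//.
  rewrite -[LHS]/(s^-1%:E * nu _)%E nuE.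
  by congr (_ * leb _)%E; apply/funext => x /=; rewrite /F mulrBr.
have mp : measurable_fun A (fun x => (normal_pdf (0 : R) 1 x)%:E).
  by apply/measurable_EFinP/measurable_funTS; exact: measurable_normal_pdf.
rewrite ge0_integral_mscale//; last first.
  by move=> x _; rewrite lee_fin normal_pdf_ge0.
rewrite nuE ge0_integral_pushforward//; last first.
  by move=> x _; rewrite lee_fin normal_pdf_ge0.
have mFA : measurable (F @^-1` A) by rewrite -[X in measurable X]setTI; exact: mF.
rewrite -ge0_integralZl//; last 2 first.
- apply: measurable_funTS; apply/measurable_EFinP.
  exact: (measurableT_comp (measurable_normal_pdf 0 1) mF).
- by move=> x _; rewrite lee_fin normal_pdf_ge0.
apply: eq_integral => x _; rewrite /= -EFinM; congr EFin.
rewrite !normal_pdfE ?oner_neq0 ?gt_eqF// /normal_peak /normal_fun /F.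
rewrite mulrA; congr (_ * expR _).
  rewrite -mulrnAr sqrtrM ?sqr_ge0// sqrtr_sqr gtr0_norm// expr1n.
  by rewrite -mulrnAr mul1r invfM.
by rewrite subr0 expr1n; field; rewrite gt_eqF.
Qed.

End normal.

(** * Moment generating function and Chernoff bounds of chi-square laws *)

Section chi_square.
Context {R : realType}.
Local Notation leb := (@lebesgue_measure R).
Local Notation chi := (@chi_square_prob R).

(** The tilted standard density is s times the density of a centred normal law of variance s^2 =
    1/(1 - t), which integrates to 1. *)
Lemma normal_mgf_sqr (t : R) : t < 1 ->
  (\int[normal_prob (0 : R) 1]_x (expR (t / 2 * x ^+ 2))%:E =
   ((Num.sqrt (1 - t))^-1)%:E)%E.
Proof.
move=> t1; have t0 : 0 < 1 - t by rewrite subr_gt0.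
have q0 : 0 < Num.sqrt (1 - t) by rewrite sqrtr_gt0.
have mf : measurable_fun setT (fun x : R => expR (t / 2 * x ^+ 2)).
  apply: measurableT_comp => //; exact: measurable_funM.
rewrite ge0_integral_normal_prob; last 2 first.
- by apply/measurable_EFinP.
- by move=> x; rewrite lee_fin expR_ge0.
set s := (Num.sqrt (1 - t))^-1.
have s0 : 0 < s by rewrite invr_gt0.
have sE : s ^+ 2 = (1 - t)^-1 by rewrite exprVn sqr_sqrtr// ltW.
transitivity (\int[leb]_x (s%:E * (normal_pdf 0 s x)%:E))%E.
  apply: eq_integral => x _; rewrite -!EFinM; congr EFin.
  rewrite !normal_pdfE ?oner_neq0 ?gt_eqF// /normal_peak /normal_fun.
  rewrite !subr0 expr1n -(mulrnAr (s ^+ 2)) sqrtrM ?sqr_ge0// sqrtr_sqr.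
  rewrite (gtr0_norm s0) !mul1r invfM !mulrA divff ?gt_eqF// mul1r sE.
  rewrite (mulrAC (expR _)) -expRD mulrC; congr (_ * expR _).
  by field; rewrite gt_eqF.
rewrite ge0_integralZl//; last 3 first.
- by apply/measurable_EFinP; exact: measurable_normal_pdf.
- by move=> x _; rewrite lee_fin normal_pdf_ge0.
- by rewrite lee_fin ltW.
by rewrite integral_normal_pdf mule1.
Qed.

Lemma measurable_expR_scale (t : R) :
  measurable_fun setT (fun x : R => (expR (t * x))%:E).
Proof.
by apply/measurable_EFinP; apply: measurableT_comp => //.
Qed.

(** Tonelli splits off one squared normal variable at a time, and each contributes the same
    factor. *)
Lemma chi_square_mgf (t : R) (d : nat) : t < 1 ->
  (\int[chi d]_x (expR (t / 2 * x))%:E = ((Num.sqrt (1 - t))^-1 ^+ d)%:E)%E.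
Proof.
move=> t1; elim: d => [|d IHd] /=.
  rewrite integral_dirac//; last exact: measurable_expR_scale.
  by rewrite diracT mul1e mulr0 expR0 expr0.
rewrite ge0_integral_distribution; last 2 first.
- exact: measurable_expR_scale.
- by move=> x; rewrite lee_fin expR_ge0.
rewrite fubini_tonelli1/=; last 2 first.
- apply: (measurableT_comp (measurable_expR_scale (t / 2))).
  exact: measurable_add_sqr.
- by move=> x; rewrite lee_fin expR_ge0.
rewrite /fubini_F/=.
transitivity (\int[normal_prob (0 : R) 1]_x ((expR (t / 2 * x ^+ 2))%:E *
    ((Num.sqrt (1 - t))^-1 ^+ d)%:E))%E.
  apply: eq_integral => x _; rewrite -IHd -ge0_integralZl//; last first.
    exact: measurable_expR_scale.
  by apply: eq_integral => y _; rewrite /add_sqr/= mulrDr expRD EFinM.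
rewrite ge0_integralZr; last 4 first.
- by [].
- by apply/measurable_EFinP; apply: measurableT_comp => //; exact: measurable_funM.
- by move=> x _; rewrite lee_fin expR_ge0.
- by rewrite lee_fin exprn_ge0// invr_ge0 sqrtr_ge0.
by rewrite normal_mgf_sqr// -EFinM exprS.
Qed.

Lemma measurable_chi_tail (c b : R) : measurable [set x : R | 0 <= c * (x - b)].
Proof.
rewrite -[X in measurable X]setTI.
have := @measurable_fun_le _ R R setT (cst 0) (fun x => c * (x - b)) measurableT.
apply => //; apply: measurable_funM => //; exact: measurable_funB.
Qed.

(** Exponential Markov inequality: exp(t (x - c d) / 2) is at least 1 on the event. The sign of t
    selects the upper or the lower tail, so one statement covers both. *)
Lemma chi_square_chernoff (t c : R) (d : nat) : t < 1 ->
  (chi d [set x | 0 <= t * (x - c * d%:R)]%R <=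
   ((expR (- (t * c / 2)) / Num.sqrt (1 - t)) ^+ d)%:E)%E.
Proof.
move=> t1; set A := [set x | _].
have mA : measurable A by exact: measurable_chi_tail.
rewrite -[A]setIT -integral_indic//.
apply: (@le_trans _ _ (\int[chi d]_x
    ((expR (- (t * c / 2)) ^+ d)%:E * (expR (t / 2 * x))%:E))%E).
  apply: ge0_le_integral; first by [].
  - by move=> x _; rewrite lee_fin indicE.
  - exact/measurable_EFinP/measurable_indic.
  - by apply: measurable_funeM; exact: measurable_expR_scale.
  - move=> x _; rewrite -EFinM lee_fin indicE.
    case: (boolP (x \in A)) => /= xA; last first.
      by rewrite mulr_ge0// ?exprn_ge0 ?expR_ge0.
    rewrite -expRM_natl -expRD -[leLHS]expR0 ler_expR.
    move: xA; rewrite inE /A/= => xA.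
    have -> : d%:R * - (t * c / 2) + t / 2 * x = (t * (x - c * d%:R)) / 2.
      by field.
    by rewrite divr_ge0.
rewrite ge0_integralZl; last 4 first.
- by [].
- exact: measurable_expR_scale.
- by move=> y _; rewrite lee_fin expR_ge0.
- by rewrite lee_fin exprn_ge0// expR_ge0.
by rewrite chi_square_mgf// -EFinM exprMn.
Qed.

Lemma chi_square_tail (c : R) : 0 < c -> c != 1 ->
  exists2 r : R, 0 < r < 1 & forall d : nat,
    (chi d [set x | 0 <= (c - 1) * (x - c * d%:R)]%R <= (r ^+ d)%:E)%E.
Proof.
(* This t has the sign of c - 1, and e^(tc) (1 - t) >= (1 + tc)(1 - t) > 1. *)
move=> c0 c1; pose t := (c - 1) / (2 * c).
have t1 : t < 1 by rewrite ltr_pdivrMr ?mulr_gt0//; lra.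
have q0 : 0 < 1 - t by rewrite subr_gt0.
exists (expR (- (t * c / 2)) / Num.sqrt (1 - t)); last first.
  move=> d; rewrite (_ : [set x | _] = [set x | 0 <= t * (x - c * d%:R)]).
    exact: chi_square_chernoff.
  have tE x : (0 <= t * (x - c * d%:R)) = (0 <= (c - 1) * (x - c * d%:R)).
    by rewrite /t mulrAC pmulr_lge0// invr_gt0 mulr_gt0.
  by apply/seteqP; split => x /=; rewrite tE.
rewrite divr_gt0 ?expR_gt0 ?sqrtr_gt0//= ltr_pdivrMr ?sqrtr_gt0// mul1r.
rewrite -ltr_sqr ?nnegrE ?expR_ge0 ?sqrtr_ge0// sqr_sqrtr ?ltW//.
rewrite -expRM_natl mulrN expRN -ltf_pV2 ?posrE ?invr_gt0 ?expR_gt0// invrK.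
have -> : 2 * (t * c / 2) = t * c by field.
apply: lt_le_trans (expR_ge1Dx _).
rewrite -[ltLHS]mul1r ltr_pdivrMr//.
have -> : (1 + t * c) * (1 - t) = 1 + (c - 1) ^+ 2 / (4 * c).
  by rewrite /t; field; rewrite gt_eqF.
rewrite ltrDl; apply: divr_gt0; last by rewrite mulr_gt0.
by rewrite exprn_even_gt0//= subr_eq0 c1.
Qed.

End chi_square.

(** * Null sets of product measures through their sections *)

Section product_null.
Context d1 d2 (T1 : measurableType d1) (T2 : measurableType d2) (R : realType).
Variables (m1 : {sigma_finite_measure set T1 -> \bar R})
          (m2 : {sigma_finite_measure set T2 -> \bar R}).

Lemma product_measure_ysection0 (A : set (T1 * T2)) : measurable A ->
  (forall y, m1 [set x | A (x, y)] = 0%E) -> (m1 \x m2)%E A = 0%E.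
Proof.
move=> mA A0; rewrite -[A]setIT -integral_indic// fubini_tonelli2/=; last 2 first.
- exact/measurable_EFinP/measurable_indic.
- by move=> x; rewrite lee_fin indicE.
rewrite integral0_eq// => y _; rewrite /fubini_G.
have mAy : measurable [set x | A (x, y)].
  by have := measurable_ysection y mA; rewrite ysectionE.
rewrite (eq_integral (fun x => (\1_[set x | A (x, y)] x)%:E)).
  by rewrite integral_indic// setIT; exact: A0.
by move=> x _; rewrite !indicE; congr (_%:R%:E); apply/idP/idP; rewrite !inE.
Qed.

Lemma product_measure_xsection0 (A : set (T1 * T2)) : measurable A ->
  (forall x, m2 [set y | A (x, y)] = 0%E) -> (m1 \x m2)%E A = 0%E.
Proof.
move=> mA A0; rewrite -[A]setIT -integral_indic// fubini_tonelli1/=; last 2 first.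
- exact/measurable_EFinP/measurable_indic.
- by move=> x; rewrite lee_fin indicE.
rewrite integral0_eq// => x _; rewrite /fubini_F.
have mAx : measurable [set y | A (x, y)].
  by have := measurable_xsection x mA; rewrite xsectionE.
rewrite (eq_integral (fun y => (\1_[set y | A (x, y)] y)%:E)).
  by rewrite integral_indic// setIT; exact: A0.
by move=> y _; rewrite !indicE; congr (_%:R%:E); apply/idP/idP; rewrite !inE.
Qed.

End product_null.

(** * Existence of quantiles for laws without atoms *)

Section quantile.
Context d (T : measurableType d) (R : realType) (P : probability T R).

(** The solution is the supremum of the points where the distribution function g is below a; this
    set is nonempty and bounded because of the limits 0 and 1 of g at infinity. *)
Lemma cdf_surj (X : T -> R) (a : R) : measurable_fun setT X ->
  (forall x, P (X @^-1` [set x]) = 0%E) -> 0 < a < 1 ->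
  exists x, P [set w | X w <= x] = a%:E.
Proof.
move=> mX X0 /andP[a0 a1].
have mXle x := measurable_sublevel x mX.
have mXlt x : measurable [set w | X w < x].
  rewrite -[X in measurable X]setTI (_ : [set w | _] = X @^-1` `]-oo, x[).
    exact: (mX measurableT).
  by apply/seteqP; split => w /=; rewrite in_itv/=.
have mXeq x : measurable (X @^-1` [set x]).
  by rewrite -[X in measurable X]setTI; exact: mX.
pose Z : {RV P >-> R} := mfun_Sub (mem_set mX).
have GE x : cdf Z x = P [set w | X w <= x].
  rewrite (_ : [set w | X w <= x] = Z @^-1` `]-oo, x]); first by [].
  by apply/seteqP; split => w /=; rewrite in_itv/=.
pose g x := fine (cdf Z x).
have gE x : (g x)%:E = P [set w | X w <= x].
  by rewrite /g fineK ?GE// fin_num_measure.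
have gndec x y : x <= y -> g x <= g y.
  by move=> xy; rewrite fine_le ?fin_num_measure// cdf_nondecreasing.
have gNy : g @ -oo --> (0 : R) by exact/fine_cvg/cvg_cdfNy0.
have gy : g @ +oo --> (1 : R) by exact/fine_cvg/cvg_cdfy1.
pose S := [set x | g x < a].
have S0 : S !=set0.
  by near (@ninfty_nbhs R) => x; exists x; near: x; exact: (cvgr_lt _ gNy).
have [M gM] : exists M, a < g M.
  by near (@pinfty_nbhs R) => x; exists x; near: x; exact: (cvgr_gt _ gy).
have SM : ubound S M.
  move=> x; rewrite /S/= => gx; rewrite leNgt; apply/negP => Mx.
  by move: (lt_trans gx gM); rewrite ltNge gndec// ltW.
have supS : has_sup S by split => //; exists M.
exists (sup S); rewrite -gE; congr EFin; apply/eqP; rewrite eq_le; apply/andP; split.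
(* The open half-line is the increasing union of closed ones ending before [sup S], each of
   probability below a. Since [sup S] is no atom, closing it adds nothing. *)
- have PltS : (P [set w | (X w < sup S)%R] <= a%:E)%E.
    pose F n := [set w | X w <= sup S - n.+1%:R^-1].
    have UF : \bigcup_n F n = [set w | X w < sup S].
      apply/seteqP; split => w /=.
        move=> [n _]; rewrite /F/= => /le_lt_trans; apply.
        by rewrite ltrBlDr ltrDl invr_gt0.
      rewrite -subr_gt0 => /ltr_add_invr[n]; rewrite add0r => Xn.
      by exists n => //; rewrite /F/= lerBrDr -lerBrDl ltW.
    have cF : (P \o F) n @[n --> \oo] --> P (\bigcup_n F n).
      apply: nondecreasing_cvg_mu; [by move=> n; exact: mXle|by rewrite UF|].
      move=> n k nk; apply/subsetPset => w /=; rewrite /F/= => /le_trans; apply.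
      by rewrite lerD2l lerN2 lef_pV2 ?posrE// ler_nat.
    rewrite -UF; apply: (cvge_le _ cF).
    apply: nearW => n /=; rewrite /F -gE lee_fin.
    have [x Sx xn] : exists2 x, S x & sup S - n.+1%:R^-1 < x.
      by apply: sup_adherent; rewrite ?invr_gt0.
    by rewrite (le_trans (gndec _ _ (ltW xn)))// ltW.
  rewrite -lee_fin gE; apply: le_trans PltS.
  rewrite -[leRHS]adde0 -(X0 (sup S)); apply: le_trans (measureU2 _ _ _) => //.
  apply: le_measure; rewrite ?inE//; first exact: measurableU.
  by move=> w /=; rewrite le_eqVlt => /orP[/eqP ->|]; [right|left].
(* To the right of [sup S] the values of g are at least a; right continuity passes this to
   [sup S]. *)
- have gr : g x @[x --> (sup S)^'+] --> g (sup S).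
    apply/fine_cvg; rewrite fineK ?fin_num_measure//.
    exact: cdf_right_continuous.
  apply: (cvgr_to_ge gr); near=> x; rewrite leNgt; apply/negP => gx.
  have : x <= sup S by apply: ub_le_sup => //; exists M.
  by apply/negP; rewrite -ltNge; near: x; exact: nbhs_right_gt.
Unshelve. all: by end_near. Qed.

End quantile.

(** * The F-distribution has no atoms and its quantiles solve their equation *)

Section F_ratio.
Context {R : realType}.
Local Notation chi := (@chi_square_prob R).

(** Inversion is continuous on each open half-line, and the remaining point 0 is a measurable
    singleton. *)
Lemma measurable_invr : measurable_fun setT (fun x : R => x^-1).
Proof.
have -> : [set: R] = ([set x | x < 0] `|` [set x | 0 < x]) `|` [set 0].
  apply/seteqP; split=> // x _ /=.
  by have [x0|x0|->] := ltgtP x 0; [left; left|left; right|right].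
have o1 : open [set x : R | x < 0] by exact: open_lt.
have o2 : open [set x : R | 0 < x] by exact: open_gt.
apply/measurable_funU => //; [exact: open_measurable (openU _ _)|split].
  apply/measurable_funU; [exact: open_measurable|exact: open_measurable|].
  split; apply: open_continuous_measurable_fun => // x; rewrite inE /= => x0.
    by apply: continuousV; [rewrite lt_eqF|].
  by apply: continuousV; [rewrite gt_eqF|].
exact: measurable_fun_set1.
Qed.

Lemma measurable_F_ratio (d1 d2 : nat) : measurable_fun setT (@F_ratio R d1 d2).
Proof.
apply: measurable_funM; first exact: measurable_funM.
apply: (measurableT_comp measurable_invr).
exact: measurable_funM.
Qed.

Lemma normal_prob_countable (A : set R) : measurable A -> countable A ->
  normal_prob 0 1 A = 0%E.
Proof.
move=> mA cA.
have /null_content_dominatesP dom := normal_prob_dominates (0 : R) 1.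
by apply: dom => //; exact: countable_lebesgue_measure0.
Qed.

(** Given the sum y of the other squares, at most the two points sqrt(c - y) and its opposite reach
    c, and a finite set is null for the normal law. For d = 0 the law is the Dirac mass at 0. *)
Lemma chi_square_set1 (d : nat) (c : R) : (0 < d)%N -> chi d [set c] = 0%E.
Proof.
case: d => // d _ /=; rewrite /distribution/= /pushforward.
apply: product_measure_ysection0.
  by rewrite -[X in measurable X]setTI; exact: measurable_add_sqr.
move=> y; pose s := Num.sqrt (c - y).
have sub : [set x | add_sqr (x, y) = c] `<=` [set s; - s].
  move=> x /= xy; have -> : s = `|x|.
    by rewrite /s -xy /add_sqr/= addrK sqrtr_sqr.
  have [x0|x0] := leP 0 x; first by left; rewrite ger0_norm.
  by right; rewrite ltr0_norm// opprK.
apply: normal_prob_countable.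
  have := measurable_ysection y (A := @add_sqr R @^-1` [set c]).
  rewrite ysectionE; apply.
  by rewrite -[X in measurable X]setTI; exact: measurable_add_sqr.
apply: sub_countable (subset_card_le sub) _; apply: finite_set_countable.
exact: finite_set2.
Qed.

Lemma F_ratio_null (d1 d2 : nat) (x : R) : (0 < d1)%N -> (0 < d2)%N ->
  (chi d1 \x chi d2)%E (@F_ratio R d1 d2 @^-1` [set x]) = 0%E.
Proof.
move=> d1_gt0 d2_gt0.
have mA : measurable (@F_ratio R d1 d2 @^-1` [set x]).
  by rewrite -[X in measurable X]setTI; exact: measurable_F_ratio.
(* Where the numerator vanishes the ratio is 0 for every denominator, so this null event is removed
   first; elsewhere each section is contained in a single point. *)
pose U0 := [set 0 : R] `*` [set: R].
have mU0 : measurable U0 by exact: measurableX.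
have PU0 : (chi d1 \x chi d2)%E U0 = 0%E.
  transitivity (chi d1 [set 0%R] * chi d2 setT)%E.
    exact: product_measure1E.
  by rewrite chi_square_set1// mul0e.
apply/eqP; rewrite eq_le measure_ge0 andbT.
pose A' := @F_ratio R d1 d2 @^-1` [set x] `\` U0.
have mA' : measurable A' by exact: measurableD.
have PA' : (chi d1 \x chi d2)%E A' = 0%E.
  apply: product_measure_xsection0 => // u.
  have mu_ : measurable [set y | A' (u, y)].
    by have := measurable_xsection u mA'; rewrite xsectionE.
  apply/eqP; rewrite eq_le measure_ge0 andbT.
  rewrite -(chi_square_set1 (u / d1%:R / x * d2%:R) d2_gt0).
  apply: le_measure; rewrite ?inE//.
  move=> v [/= Fx /not_andP[u0|nT]]; last by case: nT.
  have {}u0 : u != 0 by apply/eqP.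
  have d1u : (d1%:R : R) != 0 by rewrite pnatr_eq0 -lt0n.
  have d2u : (d2%:R : R) != 0 by rewrite pnatr_eq0 -lt0n.
  (* As the inverse of 0 is 0, a zero denominator gives x = 0, and the formula for the point then
     gives 0 as well. *)
  rewrite -Fx /F_ratio/=; have [->|v0] := eqVneq v 0.
    by rewrite mul0r invr0 !mulr0 invr0 mulr0 mul0r.
  by field; rewrite u0 d1u d2u v0.
apply: (@le_trans _ _ ((chi d1 \x chi d2)%E U0 + (chi d1 \x chi d2)%E A')%E);
  last by rewrite PU0 PA' adde0.
apply: le_trans (measureU2 _ mU0 mA').
apply: le_measure; rewrite ?inE//; first exact: measurableU.
by move=> p Fp; have [pU|pU] := pselect (U0 p); [left|right].
Qed.

(** Existence of a solution ensures that [xget] returns one of them and not its default value. *)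
Lemma F_cdf_quantile (d1 d2 : nat) (a : R) : (0 < d1)%N -> (0 < d2)%N ->
  0 < a < 1 -> F_cdf d1 d2 (F_quantile d1 d2 a) = a%:E.
Proof.
move=> d1_gt0 d2_gt0 a01.
have [x xa] : exists x, F_cdf d1 d2 x = a%:E.
  apply: (cdf_surj (measurable_F_ratio d1 d2)) => // x.
  exact: F_ratio_null.
exact: (xgetPex 0 (ex_intro [set x | F_cdf d1 d2 x = a%:E] x xa)).
Qed.

End F_ratio.

(** * Tail bounds for the F-distribution and the bound at one stage *)

Section F_tails.
Context {R : realType}.
Local Notation chi := (@chi_square_prob R).

(** A tolerance e/3 on both terms suffices: (1 + e)(1 - e/3) exceeds 1 + e/3 because e < 1. *)
Lemma F_ratio_bounds (e x y : R) : 0 < e < 1 ->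
  1 - e / 3 < x < 1 + e / 3 -> 1 - e / 3 < y < 1 + e / 3 ->
  1 - e < x / y < 1 + e.
Proof.
move=> /andP[e0 e1] /andP[xl xu] /andP[yl yu].
have y0 : 0 < y by lra.
rewrite ltr_pdivlMr// ltr_pdivrMr//; apply/andP; split; nra.
Qed.

(** If the ratio is off by e, the numerator or the denominator is off by e/3 on one side: four
    chi-square tails, each at most r^n. The rate r depends on e alone. *)
Lemma F_ratio_tail (e : R) : 0 < e < 1 -> exists2 r : R, 0 < r < 1 &
  forall d1 d2 n : nat,
    (0 < d1)%N -> (0 < d2)%N -> (n <= d1)%N -> (n <= d2)%N ->
  forall A, measurable A ->
    A `<=` [set p | ~~ (1 - e < F_ratio d1 d2 p < 1 + e)] ->
    ((chi d1 \x chi d2) A <= (4 * r ^+ n)%:E)%E.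
Proof.
move=> e01; have /andP[e0 e1] := e01.
have [r1 /andP[r10 r11] H1] : exists2 r : R, 0 < r < 1 & forall d : nat,
    (chi d [set x | 0 <= ((1 - e / 3) - 1) * (x - (1 - e / 3) * d%:R)]%R
       <= (r ^+ d)%:E)%E.
  by apply: chi_square_tail; [lra|rewrite lt_eqF//; lra].
have [r2 /andP[r20 r21] H2] : exists2 r : R, 0 < r < 1 & forall d : nat,
    (chi d [set x | 0 <= ((1 + e / 3) - 1) * (x - (1 + e / 3) * d%:R)]%R
       <= (r ^+ d)%:E)%E.
  by apply: chi_square_tail; [lra|rewrite gt_eqF//; lra].
pose r := Num.max r1 r2.
have r0 : 0 < r by rewrite lt_max r10.
have r1r : r1 <= r by rewrite le_max lexx.
have r2r : r2 <= r by rewrite le_max lexx orbT.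
have r_lt1 : r < 1 by rewrite gt_max r11.
exists r; first by rewrite r0.
move=> d1 d2 n d1_gt0 d2_gt0 nd1 nd2 A mA sA.
pose L d := [set x : R | 0 <= ((1 - e / 3) - 1) * (x - (1 - e / 3) * d%:R)].
pose U d := [set x : R | 0 <= ((1 + e / 3) - 1) * (x - (1 + e / 3) * d%:R)].
have mL d : measurable (L d) by exact: measurable_chi_tail.
have mU d : measurable (U d) by exact: measurable_chi_tail.
have chiL d : (n <= d)%N -> (chi d (L d) <= (r ^+ n)%:E)%E.
  move=> nd; apply: (le_trans (H1 d)); rewrite lee_fin.
  apply: (@le_trans _ _ (r1 ^+ n)).
    by apply: ler_wiXn2l => //; rewrite ltW.
  by apply: lerXn2r => //; rewrite nnegrE ltW.
have chiU d : (n <= d)%N -> (chi d (U d) <= (r ^+ n)%:E)%E.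
  move=> nd; apply: (le_trans (H2 d)); rewrite lee_fin.
  apply: (@le_trans _ _ (r2 ^+ n)).
    by apply: ler_wiXn2l => //; rewrite ltW.
  by apply: lerXn2r => //; rewrite nnegrE ltW.
have inner d x : (0 < d)%N -> ~ L d x -> ~ U d x -> 1 - e / 3 < x / d%:R < 1 + e / 3.
  move=> d_gt0; have d0 : 0 < d%:R :> R by rewrite ltr0n.
  rewrite /L /U/= => /negP + /negP; rewrite -!ltNge.
  rewrite ltr_pdivlMr// ltr_pdivrMr// => h1 h2.
  by apply/andP; split; nra.
pose E := [set p : R * R | L d1 p.1] `|` [set p | U d1 p.1] `|`
  ([set p | L d2 p.2] `|` [set p | U d2 p.2]).
have XT (B : set R) : [set p : R * R | B p.1] = B `*` setT.
  by apply/seteqP; split => [[a b]//=|[a b] []//].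
have TX (B : set R) : [set p : R * R | B p.2] = setT `*` B.
  by apply/seteqP; split => [[a b]//=|[a b] []//].
have PX (B : set R) b : measurable B -> (chi d1 B <= b)%E ->
    ((chi d1 \x chi d2) [set p : R * R | B p.1] <= b)%E.
  move=> mB; apply: le_trans; rewrite XT.
  apply: (@le_trans _ _ (chi d1 B * chi d2 setT)%E);
    last by rewrite probability_setT mule1.
  by rewrite le_eqVlt; apply/orP; left; apply/eqP; exact: product_measure1E.
have PY (B : set R) b : measurable B -> (chi d2 B <= b)%E ->
    ((chi d1 \x chi d2) [set p : R * R | B p.2] <= b)%E.
  move=> mB; apply: le_trans; rewrite TX.
  apply: (@le_trans _ _ (chi d1 setT * chi d2 B)%E);
    last by rewrite probability_setT mul1e.
  by rewrite le_eqVlt; apply/orP; left; apply/eqP; exact: product_measure1E.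
have mX1 (B : set R) : measurable B -> measurable [set p : R * R | B p.1].
  by move=> mB; rewrite XT; exact: measurableX.
have mX2 (B : set R) : measurable B -> measurable [set p : R * R | B p.2].
  by move=> mB; rewrite TX; exact: measurableX.
apply: (@le_trans _ _ ((chi d1 \x chi d2)%E E)).
  apply: le_measure; rewrite ?inE//.
    by apply: measurableU; apply: measurableU;
      [exact: mX1|exact: mX1|exact: mX2|exact: mX2].
  move=> p /sA /=; apply: contraPP => /not_orP[/not_orP[n1 n2] /not_orP[n3 n4]].
  apply/negP; rewrite negbK; apply: F_ratio_bounds => //; exact: inner.
apply: le_trans (measureU2 _ _ _) _; [by apply: measurableU; exact: mX1|
  by apply: measurableU; exact: mX2|].
have -> : (4 * r ^+ n)%:E =
  (((r ^+ n)%:E + (r ^+ n)%:E) + ((r ^+ n)%:E + (r ^+ n)%:E))%E.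
  by rewrite -!EFinD; congr EFin; ring.
apply: leeD; apply: le_trans (measureU2 _ _ _) _.
- exact: mX1.
- exact: mX1.
- by apply: leeD; apply: PX => //; [exact: chiL|exact: chiU].
- exact: mX2.
- exact: mX2.
- by apply: leeD; apply: PY => //; [exact: chiL|exact: chiU].
Qed.

(** The square of x is at most the product of its two bounds. The mean keeps both a factor vanishing
    with z and a geometric factor in n. *)
Lemma le_geometric_mean (M K z r : R) (n : nat) (x : \bar R) :
  0 <= M -> 0 <= K -> 0 <= z -> 0 <= r -> (0 <= x)%E ->
  (x <= (M * z)%:E)%E -> (x <= (K * r ^+ n)%:E)%E ->
  (x <= (Num.sqrt (M * K) * Num.sqrt z * Num.sqrt r ^+ n)%:E)%E.
Proof.
move=> M0 K0 z0 r0; case: x => [x| |]//; rewrite !lee_fin => x0 xM xK.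
have y0 : 0 <= Num.sqrt (M * K) * Num.sqrt z * Num.sqrt r ^+ n.
  by rewrite !mulr_ge0// ?exprn_ge0// sqrtr_ge0.
rewrite -ler_sqr ?nnegrE// !exprMn -exprM mulnC exprM !sqr_sqrtr ?mulr_ge0//.
have -> : M * K * z * r ^+ n = (M * z) * (K * r ^+ n) by ring.
by rewrite expr2 ler_pM.
Qed.

Lemma F_upper_quantile (d1 d2 : nat) (a : R) : (0 < d1)%N -> (0 < d2)%N ->
  0 < a < 1 ->
  ((chi d1 \x chi d2) [set p | F_quantile d1 d2 (1 - a) < F_ratio d1 d2 p]%R = a%:E)%E.
Proof.
move=> d1_gt0 d2_gt0 /andP[a0 a1].
have qE : F_cdf d1 d2 (F_quantile d1 d2 (1 - a)) = (1 - a)%:E.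
  by apply: F_cdf_quantile => //; lra.
set x := F_quantile _ _ _ in qE *.
have -> : [set p | x < F_ratio d1 d2 p] = ~` [set p | F_ratio d1 d2 p <= x].
  by apply/seteqP; split => w /=; rewrite ltNge => /negP.
rewrite probability_setC; last first.
  by apply: measurable_sublevel; exact: measurable_F_ratio.
by rewrite -[X in (_ - X)%E]/(F_cdf d1 d2 x) qE -EFinB; congr EFin; ring.
Qed.

(** Here t1 and t2 play theta_i' and theta_i''; dividing the thresholds by t2 and by t1 corresponds
    to the extreme parameters theta = t2 and theta = t1. The constants C and q are fixed before z
    and the degrees of freedom. *)
Lemma F_ratio_stage_bound (t1 t2 : R) (a b : R -> R) : 0 < t1 -> t1 < t2 ->
  (forall z, 0 < z -> 0 < a z < 1) -> (forall z, 0 < z -> 0 < b z < 1) ->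
  order_zeta a -> order_zeta b ->
  exists C q : R, [/\ 0 < C, 0 < q < 1 & \forall z \near 0^'+,
    forall d1 d2 n : nat,
    (0 < d1)%N -> (0 < d2)%N -> (n <= d1)%N -> (n <= d2)%N ->
    let u := Num.max 1 (F_quantile d1 d2 (1 - a z)) in
    let v := Num.min 1 (F_quantile d1 d2 (b z)) in
    ((chi d1 \x chi d2) [set p | F_ratio d1 d2 p <=
       Num.min (t2 * v) ((t1 * u + t2 * v) / 2) / t2]%R <=
       (C * Num.sqrt z * q ^+ n)%:E)%E /\
    ((chi d1 \x chi d2) [set p |
       Num.max (t1 * u) ((t1 * u + t2 * v) / 2) / t1 < F_ratio d1 d2 p]%R <=
       (C * Num.sqrt z * q ^+ n)%:E)%E].
Proof.
move=> t1_gt0 t12 a01 b01 [Aa [Ba [Aa0 Ba0 aO]]] [Ab [Bb [Ab0 Bb0 bO]]].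
have t2_gt0 : 0 < t2 by exact: lt_trans t12.
(* With this choice t2 (1 - e) = (t1 + 3 t2)/4 and t1 (1 + e) <= (3 t1 + t2)/4, the midpoints
   between (t1 + t2)/2 and t2, respectively t1. *)
pose e := (t2 - t1) / (4 * t2).
have eE : e * (4 * t2) = t2 - t1 by rewrite /e divfK// gt_eqF// mulr_gt0.
have e0 : 0 < e by rewrite divr_gt0 ?subr_gt0// mulr_gt0.
have e1 : e < 1 by rewrite ltr_pdivrMr ?mulr_gt0//; lra.
have t2e : t2 * e = (t2 - t1) / 4 by rewrite -eE; field.
have t1e : t1 * e <= (t2 - t1) / 4 by rewrite -t2e ler_pM2r// ltW.
have [r /andP[r0 r1] tail] := F_ratio_tail (introT andP (conj e0 e1)).
(* [M * z] dominates both a z and b z. [K] covers the direct tail bound 4 r^n as well as its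
   transfer from a to b and from b to a. *)
pose M := Ba + Bb; pose K := 4 * (1 + Bb / Aa + Ba / Ab).
have M0 : 0 < M by rewrite addr_gt0.
have BA0 : 0 < Bb / Aa by rewrite divr_gt0.
have AB0 : 0 < Ba / Ab by rewrite divr_gt0.
have K0 : 0 < K by rewrite mulr_gt0// !addr_gt0.
exists (Num.sqrt (M * K)), (Num.sqrt r); split.
- by rewrite sqrtr_gt0 mulr_gt0.
- by rewrite sqrtr_gt0 r0/= -[ltRHS]sqrtr1 ltr_sqrt//.
near=> z; move=> d1 d2 n d1_gt0 d2_gt0 nd1 nd2.
set u := Num.max 1 _; set v := Num.min 1 _.
have z0 : 0 < z by near: z; exact: nbhs_right_gt.
have /andP[Aaz Baz] : Aa < a z / z < Ba by near: z.
have /andP[Abz Bbz] : Ab < b z / z < Bb by near: z.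
have {Aaz} Aaz : Aa * z < a z by rewrite -ltr_pdivlMr.
have {Baz} Baz : a z < Ba * z by rewrite -ltr_pdivrMr.
have {Abz} Abz : Ab * z < b z by rewrite -ltr_pdivlMr.
have {Bbz} Bbz : b z < Bb * z by rewrite -ltr_pdivrMr.
(* The positive lower constants in [order_zeta] are what bounds the ratios of a and b. *)
have ba : b z <= Bb / Aa * a z.
  have -> : Bb / Aa * a z = Bb * (a z / Aa) by ring.
  by rewrite (le_trans (ltW Bbz))// ler_wpM2l ?ltW// ltr_pdivlMr// mulrC.
have ab : a z <= Ba / Ab * b z.
  have -> : Ba / Ab * b z = Ba * (b z / Ab) by ring.
  by rewrite (le_trans (ltW Baz))// ler_wpM2l ?ltW// ltr_pdivlMr// mulrC.
have rn0 : 0 < r ^+ n by rewrite exprn_gt0.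
have u1 : 1 <= u by rewrite le_max lexx.
have v1 : v <= 1 by rewrite ge_min lexx.
have uQ : F_quantile d1 d2 (1 - a z) <= u by rewrite le_max lexx orbT.
have vQ : v <= F_quantile d1 d2 (b z) by rewrite ge_min lexx orbT.
have mle x := measurable_sublevel x (@measurable_F_ratio R d1 d2).
have mgt x := measurable_superlevel x (@measurable_F_ratio R d1 d2).
have lowE x : x <= v ->
    ((chi d1 \x chi d2) [set p | F_ratio d1 d2 p <= x]%R <= (b z)%:E)%E.
  move=> xv; rewrite -(F_cdf_quantile d1_gt0 d2_gt0 (b01 _ z0)).
  apply: le_measure; rewrite ?inE// => p /= /le_trans; apply.
  exact: le_trans vQ.
have upE x : u <= x ->
    ((chi d1 \x chi d2) [set p | x < F_ratio d1 d2 p]%R <= (a z)%:E)%E.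
  move=> ux; rewrite -(F_upper_quantile d1_gt0 d2_gt0 (a01 _ z0)).
  apply: le_measure; rewrite ?inE// => p /=; apply: le_lt_trans.
  exact: le_trans ux.
have tail_le x : x <= 1 - e ->
    ((chi d1 \x chi d2) [set p | F_ratio d1 d2 p <= x]%R <= (4 * r ^+ n)%:E)%E.
  move=> xe; apply: tail => // p /= Fx.
  by rewrite negb_and -!leNgt (le_trans Fx).
have tail_gt x : 1 + e <= x ->
    ((chi d1 \x chi d2) [set p | x < F_ratio d1 d2 p]%R <= (4 * r ^+ n)%:E)%E.
  move=> xe; apply: tail => // p /= Fx.
  by rewrite negb_and -!leNgt orbC (le_trans xe)// ltW.
split; apply: le_geometric_mean => //; try exact: ltW.
- apply: (le_trans (lowE _ _)).
    by rewrite ler_pdivrMr// mulrC ge_min lexx.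
  by rewrite lee_fin (le_trans (ltW Bbz))// ler_wpM2r ?(ltW z0)// /M lerDr ltW.
(* If t1 u is small, v <= 1 puts the average of t1 u and t2 v below t2 (1 - e), and the lower tail
   bound applies directly. *)
- have [us|us] := leP (t1 * u) ((t1 + t2) / 2).
    apply: (le_trans (tail_le _ _)).
      rewrite ler_pdivrMr// ge_min; apply/orP; right.
      have : t2 * v <= t2 by rewrite ler_piMr// ltW.
      lra.
    rewrite lee_fin ler_wpM2r ?(ltW rn0)// ler_peMr//; lra.
  have ue : 1 + e <= u.
    rewrite leNgt; apply/negP; rewrite -(ltr_pM2l t1_gt0); lra.
  (* Otherwise u >= 1 + e, so the maximum defining u is the quantile itself. Then a z is a tail
     probability beyond 1 + e, hence exponentially small, and so is b z. *)
  have Qu : F_quantile d1 d2 (1 - a z) = u.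
    move: ue; rewrite /u; case: (leP 1 (F_quantile _ _ _)) => // _.
    by rewrite gerDl leNgt e0.
  have az : a z <= 4 * r ^+ n.
    rewrite -lee_fin -(F_upper_quantile d1_gt0 d2_gt0 (a01 _ z0)) Qu.
    exact: tail_gt.
  apply: (le_trans (lowE _ _)).
    by rewrite ler_pdivrMr// mulrC ge_min lexx.
  rewrite lee_fin (le_trans ba)// (@le_trans _ _ (Bb / Aa * (4 * r ^+ n)))//.
    by rewrite ler_wpM2l// ltW.
  rewrite /K -[leRHS]mulrA mulrCA ler_pM2l// ler_wpM2r ?(ltW rn0)//; lra.
- apply: (le_trans (upE _ _)).
    by rewrite ler_pdivlMr// mulrC le_max lexx.
  by rewrite lee_fin (le_trans (ltW Baz))// ler_wpM2r ?(ltW z0)// /M lerDl ltW.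
(* Mirror image: either t2 v is large and the average exceeds t1 (1 + e), or v <= 1 - e is a true
   quantile and b z, hence a z, is exponentially small. *)
- have [vs|vs] := leP ((t1 + t2) / 2) (t2 * v).
    apply: (le_trans (tail_gt _ _)).
      rewrite ler_pdivlMr// le_max; apply/orP; right.
      have : t1 <= t1 * u by rewrite ler_peMr// ltW.
      lra.
    rewrite lee_fin ler_wpM2r ?(ltW rn0)// ler_peMr//; lra.
  have ve : v <= 1 - e.
    rewrite leNgt; apply/negP; rewrite -(ltr_pM2l t2_gt0); lra.
  have Qv : F_quantile d1 d2 (b z) = v.
    move: ve; rewrite /v; case: (leP 1 (F_quantile _ _ _)) => // _.
    by rewrite lerBrDr gerDl leNgt e0.
  have bz : b z <= 4 * r ^+ n.
    rewrite -lee_fin -(F_cdf_quantile d1_gt0 d2_gt0 (b01 _ z0)) Qv.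
    exact: tail_le.
  apply: (le_trans (upE _ _)).
    by rewrite ler_pdivlMr// mulrC le_max lexx.
  rewrite lee_fin (le_trans ab)// (@le_trans _ _ (Ba / Ab * (4 * r ^+ n)))//.
    by rewrite ler_wpM2l// ltW.
  rewrite /K -[leRHS]mulrA mulrCA ler_pM2l// ler_wpM2r ?(ltW rn0)//; lra.
Unshelve. all: by end_near. Qed.

Lemma geometric_sum_le (q : R) (n : nat) : 0 <= q < 1 ->
  \sum_(i < n) q ^+ i <= (1 - q)^-1.
Proof.
move=> /andP[q0 q1]; have q1' : 0 < 1 - q by rewrite subr_gt0.
rewrite -[leRHS]mul1r ler_pdivlMr// mulrC.
have -> : (1 - q) * \sum_(i < n) q ^+ i = 1 - q ^+ n.
  by rewrite -[LHS]opprK -mulNr opprB -subrX1 opprB.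
by rewrite gerBl exprn_ge0.
Qed.

(** The whole series sums to C sqrt(z) / (1 - q), so one z serves all n, including an n that itself
    depends on z. *)
Lemma sqrt_geometric_sum_small (C q eps : R) : 0 < C -> 0 < q < 1 -> 0 < eps ->
  \forall z \near 0^'+, forall n,
    \sum_(i < n) C * Num.sqrt z * q ^+ i <= eps.
Proof.
move=> C0 /andP[q0 q1] eps0; have q1' : 0 < 1 - q by rewrite subr_gt0.
pose k := eps * (1 - q) / C.
have k0 : 0 < k by rewrite divr_gt0// mulr_gt0.
near=> z; move=> n; rewrite -mulr_sumr.
have z0 : 0 < z by near: z; exact: nbhs_right_gt.
have zk : Num.sqrt z <= k.
  rewrite -[leRHS](gtr0_norm k0) -sqrtr_sqr ler_wsqrtr//.
  by near: z; apply: nbhs_right_le; rewrite exprn_gt0.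
apply: (@le_trans _ _ (C * k * (1 - q)^-1)).
  apply: ler_pM.
  - by rewrite mulr_ge0 ?sqrtr_ge0// ltW.
  - by apply: sumr_ge0 => i _; rewrite exprn_ge0// ltW.
  - by rewrite ler_pM2l.
  - by rewrite geometric_sum_le// ltW.
rewrite /k le_eqVlt; apply/orP; left; apply/eqP.
by field; rewrite gt_eqF//= gt_eqF.
Unshelve. all: by end_near. Qed.

End F_tails.

(** * Laws of sums of squares of independent standard normal variables *)

Section law.
Context d (T : measurableType d) (R : realType) (P : probability T R).
Local Notation chi := (@chi_square_prob R).

Lemma measurable_sum_sqr (n : nat) (Z : nat -> T -> R) :
  (forall i, measurable_fun setT (Z i)) ->
  measurable_fun setT (fun w => \sum_(i < n) Z i w ^+ 2).
Proof. by move=> mZ; apply: measurable_sum => i; exact: measurable_funX. Qed.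

Lemma measurable_cylinder (n : nat) (Z : nat -> T -> R) (B : nat -> set R) :
  (forall i, measurable_fun setT (Z i)) -> (forall i, measurable (B i)) ->
  measurable (\big[setI/setT]_(i < n) (Z i @^-1` B i)).
Proof.
move=> mZ mB; apply: bigsetI_measurable => i _.
by rewrite -[X in measurable X]setTI; exact: mZ.
Qed.

(* Carrying the event [E] lets the induction hypothesis be used with
   [Z n @^-1` B `&` E], and later lets the two samples be added one by one. *)
Lemma sum_sqr_law (n : nat) (Z : nat -> T -> R) (E : set T) :
  (forall i, measurable_fun setT (Z i)) -> measurable E ->
  (forall B : nat -> set R, (forall i, measurable (B i)) ->
    P (\big[setI/setT]_(i < n) (Z i @^-1` B i) `&` E) =
    (\prod_(i < n) normal_prob 0 1 (B i) * P E)%E) ->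
  forall A, measurable A ->
    P ((fun w => \sum_(i < n) Z i w ^+ 2) @^-1` A `&` E) = (chi n A * P E)%E.
Proof.
move=> mZ; elim: n E => [|n IHn] E mE indep A mA.
  rewrite /= diracE; have [A0|A0] := boolP (0 \in A).
    rewrite mul1e; congr (P _); apply/seteqP; split => w /=; first by case.
    by move=> Ew; split => //; rewrite big_ord0; rewrite inE in A0.
  rewrite mul0e (_ : _ `&` _ = set0) ?measure0//.
  rewrite -subset0 => w /= [+ _]; rewrite big_ord0 => A0'.
  by move/negP: A0; apply; rewrite inE.
pose W w := \sum_(i < n) Z i w ^+ 2.
have mW : measurable_fun setT W by exact: measurable_sum_sqr.
pose phi w : measurableTypeR R * R := (Z n w, W w).
have mphi : measurable_fun setT phi.
  by apply: (@measurable_fun_pair _ _ _ _ (measurableTypeR R) R) => //; exact: mZ.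
(* Leaving the first n variables unconstrained isolates the last one. *)
have PZ B : measurable B -> P (Z n @^-1` B `&` E) = (normal_prob 0 1 B * P E)%E.
  move=> mB; have := indep (fun i => if i == n then B else setT).
  rewrite !big_ord_recr/= eqxx big1 ?big1 ?setTI ?mul1e; first last.
  - by move=> i _; rewrite ltn_eqF// preimage_setT.
  - by move=> i _; rewrite ltn_eqF// probability_setT.
  by apply => i; case: ifP.
have IH A1 A2 : measurable A1 -> measurable A2 ->
    P (phi @^-1` (A1 `*` A2) `&` E) = (normal_prob 0 1 A1 * P E * chi n A2)%E.
  move=> mA1 mA2.
  have mZA : measurable (Z n @^-1` A1 `&` E).
    by apply: measurableI => //; rewrite -[X in measurable X]setTI; exact: mZ.
  rewrite -PZ// muleC -IHn//.
    by congr (P _); apply/seteqP; split => w /=; [case=> -[]|case=> ? []].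
  move=> B mB; rewrite PZ// muleA.
  (* The constraint on the last variable is appended to the others, giving a cylinder in n + 1
     variables to which [indep] applies. *)
  pose B' i := if i == n :> nat then A1 else B i.
  transitivity (P (\big[setI/setT]_(i < n.+1) (Z i @^-1` B' i) `&` E)).
    rewrite big_ord_recr/= {2}/B' eqxx setIA; congr (P (_ `&` _ `&` _)).
    by apply: eq_bigr => i _; rewrite /B' ltn_eqF.
  rewrite indep; last by move=> i; rewrite /B'; case: ifP.
  rewrite big_ord_recr/= {2}/B' eqxx; congr (_ * _ * _)%E.
  by apply: eq_bigr => i _; rewrite /B' ltn_eqF.
have c0 : 0 <= fine (P E) by rewrite fine_ge0.
have cE : (fine (P E))%:E = P E by rewrite fineK ?fin_num_measure.
pose c := NngNum c0.
pose m1 := mscale c (normal_prob (0 : R) 1).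
(* [nu] is the joint law of the last variable and the partial sum under P restricted to [E]. *)
have [nu nuE] := pushforward_is_measure (mrestr P mE) mphi.
have mA' : measurable (@add_sqr R @^-1` A).
  by rewrite -[X in measurable X]setTI; exact: measurable_add_sqr.
transitivity (nu (@add_sqr R @^-1` A)).
  rewrite nuE /pushforward /mrestr; congr (P (_ `&` _)).
  by apply/seteqP; split => w /=; rewrite big_ord_recr/= addrC.
(* On rectangles, both the restricted joint law and the multiple of the product
   law agree with [m1 \x chi n]. *)
rewrite -(@product_measure_unique _ _ _ _ _ m1 (chi n) nu _ _ mA'); last first.
  move=> A1 A2 mA1 mA2.
  transitivity (P (phi @^-1` (A1 `*` A2) `&` E)); first by rewrite nuE.
  rewrite (IH _ _ mA1 mA2) (muleC _ (P E)).
  by rewrite -[X in _ = (X * _)%E]/((fine (P E))%:E * normal_prob 0 1 A1)%E cE.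
rewrite (@product_measure_unique _ _ _ _ _ m1 (chi n)
  (mscale c (normal_prob (0 : R) 1 \x chi n)%E) _ _ mA'); last first.
  move=> A1 A2 mA1 mA2; rewrite /m1 /mscale/=.
  by rewrite -muleA; congr (_ * _)%E; exact: product_measure1E.
by rewrite -[LHS]/((fine (P E))%:E * chi n.+1 A)%E cE muleC.
Qed.

(** [sum_sqr_law] is applied twice: to the first sample with [E] a cylinder of the second, then to
    the second sample with [E] an event on the first sum. This settles rectangles, and uniqueness of
    the product measure does the rest. *)
Lemma sum_sqr_joint_law (n k : nat) (Z1 Z2 : nat -> T -> R) :
  (forall i, measurable_fun setT (Z1 i)) ->
  (forall i, measurable_fun setT (Z2 i)) ->
  (forall B1 B2 : nat -> set R,
    (forall i, measurable (B1 i)) -> (forall i, measurable (B2 i)) ->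
    P (\big[setI/setT]_(i < n) (Z1 i @^-1` B1 i) `&`
       \big[setI/setT]_(i < k) (Z2 i @^-1` B2 i)) =
    (\prod_(i < n) normal_prob 0 1 (B1 i) *
     \prod_(i < k) normal_prob 0 1 (B2 i))%E) ->
  forall C, measurable C ->
    P ((fun w => (\sum_(i < n) Z1 i w ^+ 2, \sum_(i < k) Z2 i w ^+ 2)) @^-1` C) =
    (chi n \x chi k)%E C.
Proof.
move=> mZ1 mZ2 indep C mC.
have m1 := measurable_sum_sqr n mZ1; have m2 := measurable_sum_sqr k mZ2.
have prod1 j : (\prod_(i < j) normal_prob (0 : R) 1 setT)%E = 1%E.
  by rewrite big1// => i _; exact: probability_setT.
have capT j (Z : nat -> T -> R) : \big[setI/setT]_(i < j) (Z i @^-1` setT) = setT.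
  by rewrite big1// => i _; rewrite preimage_setT.
have indep2 (B2 : nat -> set R) : (forall i, measurable (B2 i)) ->
    P (\big[setI/setT]_(i < k) (Z2 i @^-1` B2 i)) =
    (\prod_(i < k) normal_prob 0 1 (B2 i))%E.
  move=> mB2; have := indep (fun=> setT) B2.
  by rewrite capT prod1 setTI mul1e; apply.
have step1 (A : set R) (B2 : nat -> set R) :
    measurable A -> (forall i, measurable (B2 i)) ->
    P ((fun w => \sum_(i < n) Z1 i w ^+ 2) @^-1` A `&`
       \big[setI/setT]_(i < k) (Z2 i @^-1` B2 i)) =
    (chi n A * \prod_(i < k) normal_prob 0 1 (B2 i))%E.
  move=> mA mB2; rewrite -indep2//; apply: sum_sqr_law => //.
    exact: measurable_cylinder.
  by move=> B1 mB1; rewrite indep2// indep.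
have law1 A : measurable A ->
    P ((fun w => \sum_(i < n) Z1 i w ^+ 2) @^-1` A) = chi n A.
  move=> mA; have := step1 A (fun=> setT) mA.
  by rewrite capT prod1 setIT mule1; apply.
have [nu nuE] := pushforward_is_measure P (measurable_fun_pair m1 m2).
transitivity (nu C); first by rewrite nuE.
apply/esym; apply: product_measure_unique => // A1 A2 mA1 mA2.
have mU : measurable ((fun w => \sum_(i < n) Z1 i w ^+ 2) @^-1` A1).
  by rewrite -[X in measurable X]setTI; exact: m1.
transitivity (chi n A1 * chi k A2)%E; last by [].
rewrite nuE /pushforward -law1// muleC -(sum_sqr_law mZ2 mU)//.
  by congr (P _); apply/seteqP; split => w [].
move=> B2 mB2; rewrite setIC step1// law1//; exact: muleC.
Qed.

End law.

(** * Law of the variance ratio estimate *)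

Section samples.
Context d (T : measurableType d) (R : realType) (P : probability T R).
Local Notation chi := (@chi_square_prob R).
Variables (X Y : nat -> {RV P >-> R}) (muX muY sX sY : R).
Hypotheses (sX_gt0 : 0 < sX) (sY_gt0 : 0 < sY).
Hypothesis normX : forall j, is_normal (X j) muX sX.
Hypothesis normY : forall j, is_normal (Y j) muY sY.
Hypothesis indep : mutually_independent (both_samples X Y).

Let ZX j w := sX^-1 * (X j w - muX).
Let ZY j w := sY^-1 * (Y j w - muY).

Lemma measurable_standardize (Z : {RV P >-> R}) (mu s : R) :
  measurable_fun setT (fun w => s^-1 * (Z w - mu)).
Proof. by apply: measurable_funM => //; exact: measurable_funB. Qed.

Lemma standardized_normal (Z : {RV P >-> R}) (mu s : R) (B : set R) : 0 < s ->
  is_normal Z mu s -> measurable B ->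
  P (Z @^-1` ((fun x => s^-1 * (x - mu)) @^-1` B)) = normal_prob 0 1 B.
Proof.
move=> s0 nZ mB; rewrite -(normal_prob_standardize mu s0 mB) -nZ//.
rewrite -[X in measurable X]setTI.
have mF : measurable_fun setT (fun x : R => s^-1 * (x - mu)).
  by apply: measurable_funM => //; exact: measurable_funB.
exact: mF.
Qed.

(** Both families of constraints are pulled back through the standardizing maps and merged into one
    finite family indexed by [nat + nat]. *)
Lemma standardized_indep (n k : nat) (B1 B2 : nat -> set R) :
  (forall i, measurable (B1 i)) -> (forall i, measurable (B2 i)) ->
  P (\big[setI/setT]_(i < n) (ZX i @^-1` B1 i) `&`
     \big[setI/setT]_(i < k) (ZY i @^-1` B2 i)) =
  (\prod_(i < n) normal_prob 0 1 (B1 i) *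
   \prod_(i < k) normal_prob 0 1 (B2 i))%E.
Proof.
move=> mB1 mB2.
pose B (i : nat + nat) := match i with
  | inl i => (fun x => sX^-1 * (x - muX)) @^-1` B1 i
  | inr i => (fun x => sY^-1 * (x - muY)) @^-1` B2 i end.
have mB i : measurable (B i).
  have mF s mu : measurable_fun setT (fun x : R => s^-1 * (x - mu)).
    by apply: measurable_funM => //; exact: measurable_funB.
  by case: i => i; rewrite -[X in measurable X]setTI; exact: mF.
pose J : seq (nat + nat) := map inl (iota 0 n) ++ map inr (iota 0 k).
have uJ : uniq J.
  rewrite cat_uniq !map_inj_uniq ?iota_uniq//=; try by move=> ? ? [].
  by rewrite andbT; apply/hasPn => _ /mapP[i _ ->]; apply/mapP => -[].
have ordE (V : Type) (op : V -> V -> V) idx j (F : nat -> V) :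
    \big[op/idx]_(i <- iota 0 j) F i = \big[op/idx]_(i < j) F i.
  by rewrite -(big_mkord xpredT) /index_iota subn0.
have := indep uJ mB.
rewrite bigcap_seq !big_cat !big_map/= !ordE => ->.
by congr (_ * _)%E; apply: eq_bigr => i _; rewrite standardized_normal.
Qed.

(** The unknown variances factor out as theta, leaving a pivot whose law depends on the sample sizes
    only. *)
Lemma theta_hatE (nX nY : nat -> nat) (l : nat) (w : T) :
  theta_hat nX nY muX muY (X : nat -> T -> R) (Y : nat -> T -> R) l w =
  sX ^+ 2 / sY ^+ 2 * F_ratio (nX l) (nY l)
    (\sum_(i < nX l) ZX i w ^+ 2, \sum_(i < nY l) ZY i w ^+ 2).
Proof.
rewrite /theta_hat /F_ratio/=.
have scale s mu (Z : nat -> T -> R) n : 0 < s ->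
    \sum_(j < n) (Z j w - mu) ^+ 2 =
    s ^+ 2 * \sum_(j < n) (s^-1 * (Z j w - mu)) ^+ 2.
  move=> s0; rewrite mulr_sumr; apply: eq_bigr => j _.
  by rewrite exprMn mulrA -exprMn divff ?gt_eqF// expr1n mul1r.
rewrite (scale _ _ (X : nat -> T -> R) _ sX_gt0).
rewrite (scale _ _ (Y : nat -> T -> R) _ sY_gt0).
rewrite !invfM !invrK -/(ZX _ _).
set U := \sum_(j < _) (sX^-1 * _) ^+ 2; set V := (\sum_(j < _) _)^-1.
by rewrite /ZX /ZY -/U -/V; ring.
Qed.

Lemma theta_hat_law (nX nY : nat -> nat) (l : nat) (C : set R) : measurable C ->
  P [set w | C (F_ratio (nX l) (nY l)
    (\sum_(i < nX l) ZX i w ^+ 2, \sum_(i < nY l) ZY i w ^+ 2))] =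
  (chi (nX l) \x chi (nY l))%E (@F_ratio R (nX l) (nY l) @^-1` C).
Proof.
move=> mC.
rewrite -(sum_sqr_joint_law (Z1 := ZX) (Z2 := ZY) (P := P)) //.
- by move=> i; exact: measurable_standardize.
- by move=> i; exact: measurable_standardize.
- exact: standardized_indep.
- by rewrite -[X in measurable X]setTI; exact: measurable_F_ratio.
Qed.

Lemma measurable_theta_hat (nX nY : nat -> nat) (l : nat) :
  measurable_fun setT
    (theta_hat nX nY muX muY (X : nat -> T -> R) (Y : nat -> T -> R) l).
Proof.
have mS (Z : nat -> {RV P >-> R}) mu n :
    measurable_fun setT (fun w => \sum_(j < n) (Z j w - mu) ^+ 2).
  apply: measurable_sum => j; apply: measurable_funX; exact: measurable_funB.
apply: measurable_funM; first exact: measurable_funM.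
apply: (measurableT_comp measurable_invr); exact: measurable_funM.
Qed.

Let theta := sX ^+ 2 / sY ^+ 2.

Let FXY (n k : nat) w := F_ratio n k
  (\sum_(i < n) ZX i w ^+ 2, \sum_(i < k) ZY i w ^+ 2).

Let measurable_FXY n k : measurable_fun setT (FXY n k).
Proof.
apply: (measurableT_comp (measurable_F_ratio n k)).
by apply: measurable_fun_pair; apply: measurable_sum_sqr => i;
  exact: measurable_standardize.
Qed.

Let FXY_ge0 n k w : 0 <= FXY n k w.
Proof.
by rewrite /FXY /F_ratio/= !divr_ge0//; apply: sumr_ge0 => i _; exact: sqr_ge0.
Qed.

(** The pivot is nonnegative, so the estimate increases with theta, and the least parameter t is the
    worst case for small values. *)
Lemma theta_hat_le_prob (nX nY : nat -> nat) (l : nat) (t x : R) :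
  0 < t -> t <= theta ->
  (P [set w | theta_hat nX nY muX muY
     (X : nat -> T -> R) (Y : nat -> T -> R) l w <= x]%R <=
  (chi (nX l) \x chi (nY l)) [set p | F_ratio (nX l) (nY l) p <= x / t]%R)%E.
Proof.
move=> t0 tle.
have mC : measurable [set y : R | y <= x / t] by exact: measurable_sublevel.
rewrite -(theta_hat_law nX nY l mC).
apply: le_measure; rewrite ?inE.
- by apply: measurable_sublevel; exact: measurable_theta_hat.
- by apply: measurable_sublevel; exact: measurable_FXY.
- move=> w /=; rewrite theta_hatE ler_pdivlMr// => h; apply: le_trans h.
  by rewrite mulrC ler_wpM2r//; exact: FXY_ge0.
Qed.

Lemma theta_hat_gt_prob (nX nY : nat -> nat) (l : nat) (t x : R) :
  0 < t -> theta <= t ->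
  (P [set w | x < theta_hat nX nY muX muY
     (X : nat -> T -> R) (Y : nat -> T -> R) l w]%R <=
  (chi (nX l) \x chi (nY l)) [set p | x / t < F_ratio (nX l) (nY l) p]%R)%E.
Proof.
move=> t0 tle.
have mC : measurable [set y : R | x / t < y] by exact: measurable_superlevel.
rewrite -(theta_hat_law nX nY l mC).
apply: le_measure; rewrite ?inE.
- by apply: measurable_superlevel; exact: measurable_theta_hat.
- by apply: measurable_superlevel; exact: measurable_FXY.
- move=> w /=; rewrite theta_hatE ltr_pdivrMr// => h; apply: (lt_le_trans h).
  by rewrite [leRHS]mulrC ler_wpM2r//; exact: FXY_ge0.
Qed.

End samples.

(** * Wrong decisions and measurability of the rejection event *)

Section decision.
Context {R : realType}.
Variables (m s : nat) (nX nY : nat -> nat) (th1 th2 alpha beta : nat -> R).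
Local Notation dec := (decision m nX nY th1 th2 alpha beta).
Local Notation f := (f_ nX nY th1 th2 alpha beta).
Local Notation g := (g_ nX nY th1 th2 alpha beta).

(** Accepting j < i puts x below the threshold f of index j + 1 <= i; accepting j > i puts x above
    the threshold g of index j. *)
Lemma decision_wrong (l i j : nat) (x : R) : (2 <= m)%N -> (i < m)%N ->
  (j < m)%N -> j != i -> dec l x = j.+1 ->
  exists2 k, (1 <= k < m)%N & if (k <= i)%N then x <= f l k else g l k < x.
Proof.
move=> m2 im jm ji; rewrite /decision; case: ifPn => [xf [j0]|_].
  by exists 1%N; rewrite // -j0 in ji *; rewrite lt0n eq_sym ji.
case: ifPn => [xg mE|_].
  exists m.-1; first by rewrite -ltnS prednK ?m2//; lia.
  by rewrite leqNgt (_ : (i < m.-1)%N)//; lia.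
set L := [seq i <- _ | _] => hL.
(* The value j + 1 is not the default 0, so the list is nonempty and its head satisfies the
   filter. *)
have : head 0%N L \in L by case: L hL => //= a r _; rewrite mem_head.
rewrite hL mem_filter mem_index_iota => /andP[/andP[gx xf] jr].
have [ij|ij] := ltnP i j.
  exists j; first by lia.
  by rewrite leqNgt ij.
exists j.+1; first by lia.
by rewrite ltn_neqAle ji ij.
Qed.

Lemma measurable_if_eq (b : R -> bool) (y y' : R -> nat) (c : nat) :
  measurable [set x | b x] -> measurable [set x | y x = c] ->
  measurable [set x | y' x = c] ->
  measurable [set x | (if b x then y x else y' x) = c].
Proof.
move=> mb my my'.
rewrite (_ : [set x | _] = [set x | b x] `&` [set x | y x = c] `|`
    (~` [set x | b x] `&` [set x | y' x = c])).
  by apply: measurableU; apply: measurableI => //; exact: measurableC.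
apply/seteqP; split => x /=; case: ifPn => bx; first by left.
- by move=> yx; right; split => //; exact/negP.
- by case=> -[].
- by case=> -[// bx']; rewrite bx' in bx.
Qed.

Lemma measurable_decision (l c : nat) : measurable [set x | dec l x = c].
Proof.
have mcst (a : nat) : measurable [set x : R | a = c].
  have [->|ac] := eqVneq a c.
    by rewrite (_ : [set _ | _] = setT)//; exact/seteqP.
  rewrite (_ : [set _ | _] = set0)// -subset0 => x /= /eqP; exact/negP.
apply: measurable_if_eq => //; first exact: measurable_sublevel.
apply: measurable_if_eq => //; first exact: measurable_superlevel.
(* The head of a filtered list is a cascade of conditionals along the list. *)
elim: (index_iota 2 m) => [|a r IHr] /=; first exact: mcst.
rewrite (_ : [set x | _] = [set x | (if (g l a.-1 < x <= f l a) then a else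
   head 0%N [seq i <- r | g l i.-1 < x <= f l i]) = c]).
  apply: measurable_if_eq => //.
  rewrite (_ : [set x | _] = [set x | g l a.-1 < x] `&` [set x | x <= f l a]).
    by apply: measurableI; [exact: measurable_superlevel|exact: measurable_sublevel].
  by apply/seteqP; split => x /= => [/andP[]|[-> ->]].
by apply/seteqP; split => x /=; case: ifP.
Qed.

Lemma measurable_reject d (T : measurableType d) (muX muY : R)
    (X Y : nat -> T -> R) (i : nat) :
  (forall l, measurable_fun setT (theta_hat nX nY muX muY X Y l)) ->
  measurable (reject m s nX nY th1 th2 alpha beta muX muY X Y i).
Proof.
move=> mth; have mD l c : measurable
    [set w | D_ m nX nY th1 th2 alpha beta muX muY X Y l w = c].
  rewrite -[X in measurable X]setTI.
  exact: (mth l measurableT _ (measurable_decision l c)).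
apply: bigcup_measurable => j _.
rewrite (_ : accept _ _ _ _ _ _ _ _ _ _ _ _ _ =
  \bigcup_(l in [set l | (1 <= l <= s)%N])
  ((\bigcap_(k in [set k | (1 <= k < l)%N])
     [set w | D_ m nX nY th1 th2 alpha beta muX muY X Y k w = 0%N]) `&`
   [set w | D_ m nX nY th1 th2 alpha beta muX muY X Y l w = j.+1])).
  apply: bigcup_measurable => l _; apply: measurableI => //.
  exact: bigcap_measurableType.
apply/seteqP; split => w /=.
  by move=> [l [ls D0 Dl]]; exists l.
by move=> [l ls [D0 Dl]]; exists l.
Qed.

End decision.

(** Turns exponential decay in the sample size into exponential decay in the stage number. *)
Lemma strictly_increasing_gt_index (s : nat) (n : nat -> nat) : (2 <= n 1)%N ->
  (forall l, (1 <= l < s)%N -> (n l < n l.+1)%N) ->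
  forall l, (l < s)%N -> (l < n l.+1)%N.
Proof.
move=> n1 inc; elim=> [|l IHl] ls; first by lia.
by have := inc l.+1 ls; have := IHl (ltnW ls); lia.
Qed.

(** * Summation of the error bounds over the stages *)

Section stage_sums.
Context {R : realType}.
Local Notation chi := (@chi_square_prob R).

(** The bound at stage l + 1 is used with exponent l, which is below both sample sizes, so the sum
    is at most a partial geometric series. *)
Lemma stage_sum_small (t1 t2 eps : R) (a b : R -> R) (s : R -> nat)
    (nX nY : R -> nat -> nat) : 0 < t1 -> t1 < t2 -> 0 < eps ->
  (forall z, 0 < z -> 0 < a z < 1) -> (forall z, 0 < z -> 0 < b z < 1) ->
  order_zeta a -> order_zeta b ->
  (forall z l, 0 < z -> (l < s z)%N -> (l < nX z l.+1)%N) ->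
  (forall z l, 0 < z -> (l < s z)%N -> (l < nY z l.+1)%N) ->
  \forall z \near 0^'+,
    let u l := Num.max 1 (F_quantile (nX z l) (nY z l) (1 - a z)) in
    let v l := Num.min 1 (F_quantile (nX z l) (nY z l) (b z)) in
    (\sum_(l < s z) (chi (nX z l.+1) \x chi (nY z l.+1))
       [set p | F_ratio (nX z l.+1) (nY z l.+1) p <=
          Num.min (t2 * v l.+1) ((t1 * u l.+1 + t2 * v l.+1) / 2) / t2]%R
       <= eps%:E)%E /\
    (\sum_(l < s z) (chi (nX z l.+1) \x chi (nY z l.+1))
       [set p | Num.max (t1 * u l.+1) ((t1 * u l.+1 + t2 * v l.+1) / 2) / t1 <
          F_ratio (nX z l.+1) (nY z l.+1) p]%R <= eps%:E)%E.
Proof.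
move=> t1_gt0 t12 eps0 a01 b01 aO bO lX lY.
have [C [q [C0 q01 bound]]] := F_ratio_stage_bound t1_gt0 t12 a01 b01 aO bO.
have small := sqrt_geometric_sum_small C0 q01 eps0.
apply: filterS3 bound small (nbhs_right_gt 0) => z bound sz z0 /=.
have bz (l : 'I_(s z)) := bound (nX z l.+1) (nY z l.+1) l
  (leq_ltn_trans (leq0n _) (lX z l z0 (ltn_ord l)))
  (leq_ltn_trans (leq0n _) (lY z l z0 (ltn_ord l)))
  (ltnW (lX z l z0 (ltn_ord l))) (ltnW (lY z l z0 (ltn_ord l))).
split; apply: (@le_trans _ _ (\sum_(i < s z) (C * Num.sqrt z * q ^+ i)%:E)%E).
- by apply: lee_sum => l _; have [] := bz l.
- by rewrite sumEFin lee_fin.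
- by apply: lee_sum => l _; have [] := bz l.
- by rewrite sumEFin lee_fin.
Qed.

End stage_sums.

(** * Union bound over thresholds and stages *)

Theorem theorem10 (R : realType) (m : nat) (hm : (2 <= m)%N)
  (th th1 th2 : nat -> R)
  (hth_pos : 0 < th 1%N)
  (hth_incr : forall i : nat, (1 <= i)%N -> (i.+1 < m)%N -> th i < th i.+1)
  (hth12 : forall i : nat, (1 <= i < m)%N -> 0 < th1 i /\ th1 i < th i < th2 i)
  (hth21 : forall i : nat, (1 <= i)%N -> (i.+1 < m)%N -> th2 i <= th1 i.+1)
  (delta : nat -> R)
  (hdelta : forall i : nat, (i < m)%N -> 0 < delta i < 1)
  (alpha beta : R -> nat -> R)
  (halpha : forall (z : R) (i : nat),
     0 < z -> (1 <= i < m)%N -> 0 < alpha z i < 1)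
  (hbeta : forall (z : R) (i : nat),
     0 < z -> (1 <= i < m)%N -> 0 < beta z i < 1)
  (halphaO : forall i : nat, (1 <= i < m)%N -> order_zeta (alpha ^~ i))
  (hbetaO : forall i : nat, (1 <= i < m)%N -> order_zeta (beta ^~ i))
  (s : R -> nat) (nX nY : R -> nat -> nat)
  (hs : forall z : R, 0 < z -> (1 <= s z)%N)
  (hnX1 : forall z : R, 0 < z -> (2 <= nX z 1)%N)
  (hnY1 : forall z : R, 0 < z -> (2 <= nY z 1)%N)
  (hnX : forall (z : R) (l : nat), 0 < z -> (1 <= l < s z)%N ->
     (nX z l < nX z l.+1)%N)
  (hnY : forall (z : R) (l : nat), 0 < z -> (1 <= l < s z)%N ->
     (nY z l < nY z l.+1)%N)
  (hmax : forall (z : R) (i : nat), 0 < z -> (1 <= i < m)%N ->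
     th1 i * u_ (nX z) (nY z) (alpha z) (s z) i <=
     th2 i * v_ (nX z) (nY z) (beta z) (s z) i)
  (muX muY : R) :
  \forall z \near (0 : R)^'+,
    forall (i : nat), (i < m)%N ->
    forall (d : measure_display) (T : measurableType d) (P : probability T R)
      (sigmaX sigmaY : R) (X Y : nat -> {RV P >-> R}),
      0 < sigmaX -> 0 < sigmaY ->
      (forall j : nat, is_normal (X j) muX sigmaX) ->
      (forall j : nat, is_normal (Y j) muY sigmaY) ->
      mutually_independent (both_samples X Y) ->
      varTheta m th1 th2 i (sigmaX ^+ 2 / sigmaY ^+ 2) ->
      (P (reject m (s z) (nX z) (nY z) th1 th2 (alpha z) (beta z)
            muX muY (X : nat -> T -> R) (Y : nat -> T -> R) i) <= (delta i)%:E)%E.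
Proof.
have th12 i : (1 <= i < m)%N -> 0 < th1 i /\ th1 i < th2 i.
  by move=> /hth12[? /andP[h1 h2]]; split => //; exact: lt_trans h1 h2.
have th1S i : (1 <= i)%N -> (i.+1 < m)%N -> th1 i <= th1 i.+1.
  move=> i1 im; apply: le_trans (hth21 _ i1 im).
  by rewrite ltW// (th12 i _).2// i1 ltnW.
have th2S i : (1 <= i)%N -> (i.+1 < m)%N -> th2 i <= th2 i.+1.
  move=> i1 im; apply: le_trans (hth21 _ i1 im) _.
  by rewrite ltW// (th12 i.+1 _).2.
have mono (t : nat -> R) :
    (forall i, (1 <= i)%N -> (i.+1 < m)%N -> t i <= t i.+1) ->
    forall j k, (1 <= j)%N -> (j <= k)%N -> (k < m)%N -> t j <= t k.
  move=> tS j k j1; elim: k => [|k IHk]; first by rewrite leqn0 => /eqP ->.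
  rewrite leq_eqVlt ltnS => /orP[/eqP ->//|jk] km.
  exact: le_trans (IHk jk (ltnW km)) (tS k (leq_trans j1 jk) km).
have m0 : (0 < m%:R :> R) by rewrite ltr0n; exact: leq_trans hm.
(* Finitely many pairs of a hypothesis and a threshold share one range of z. Each threshold receives
   the budget delta_i / m; index 0 is excluded as thresholds are numbered from 1. *)
have sums : \forall z \near 0^'+, forall ik : 'I_m * 'I_m, (1 <= ik.2)%N ->
    (\sum_(l < s z) (chi_square_prob (nX z l.+1) \x chi_square_prob (nY z l.+1))
       [set p | F_ratio (nX z l.+1) (nY z l.+1) p <=
         f_ (nX z) (nY z) th1 th2 (alpha z) (beta z) l.+1 ik.2 / th2 ik.2]%R <=
       (delta ik.1 / m%:R)%:E)%E /\
    (\sum_(l < s z) (chi_square_prob (nX z l.+1) \x chi_square_prob (nY z l.+1))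
       [set p | g_ (nX z) (nY z) th1 th2 (alpha z) (beta z) l.+1 ik.2 / th1 ik.2 <
         F_ratio (nX z l.+1) (nY z l.+1) p]%R <=
       (delta ik.1 / m%:R)%:E)%E.
  apply: filter_forall => -[i k] /=.
  have [k0|k_gt0] := leqP k 0; first by apply: nearW.
  have km : (1 <= k < m)%N by rewrite k_gt0 ltn_ord.
  have [t1_gt0 t12] := th12 _ km.
  have d0 : 0 < delta i / m%:R.
    by rewrite divr_gt0// (andP (hdelta _ (ltn_ord i))).1.
  have grow (n : R -> nat -> nat) : (forall z, 0 < z -> (2 <= n z 1)%N) ->
      (forall z l, 0 < z -> (1 <= l < s z)%N -> (n z l < n z l.+1)%N) ->
      forall z l, 0 < z -> (l < s z)%N -> (l < n z l.+1)%N.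
    move=> n1 nS z l z0; apply: strictly_increasing_gt_index l; first exact: n1.
    by move=> l; exact: nS.
  have := stage_sum_small t1_gt0 t12 d0
    (fun z z0 => halpha z k z0 km) (fun z z0 => hbeta z k z0 km)
    (halphaO _ km) (hbetaO _ km) (grow _ hnX1 hnX) (grow _ hnY1 hnY).
  by apply: filterS => z H _; exact: H.
(* The bounds in [sums] concern F-distributions only, so the same z serves every probability space
   and all variances. *)
apply: filterS sums => z sums i im d T P sX sY X Y sX0 sY0 normX normY indep th_i.
set theta := sX ^+ 2 / sY ^+ 2 in th_i.
(* In the i-th parameter range, theta lies above theta_k'' for k <= i and, by [hi], below theta_k'
   for k > i: the worst cases of the stage bounds. *)
have lo k : (1 <= k)%N -> (k <= i)%N -> th2 k <= theta.
  move=> k1 ki; apply: le_trans (mono _ th2S _ _ k1 ki im) _.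
  have i0 : (i == 0)%N = false by lia.
  move: th_i; rewrite /varTheta i0; case: ifPn => [/eqP ->|_] /=; rewrite in_itv/=.
    by rewrite andbT.
  by case/andP.
have hi k : (i < k)%N -> (k < m)%N -> theta <= th1 k.
  move=> ik km; apply: le_trans (mono _ th1S i.+1 k isT ik km).
  move: th_i; rewrite /varTheta; case: ifPn => [/eqP ->|_] /=.
    by rewrite in_itv/= => /andP[].
  by rewrite ifF; [rewrite /= in_itv/= => /andP[]|lia].
pose th_hat := theta_hat (nX z) (nY z) muX muY
  (X : nat -> T -> R) (Y : nat -> T -> R).
pose f := f_ (nX z) (nY z) th1 th2 (alpha z) (beta z).
pose g := g_ (nX z) (nY z) th1 th2 (alpha z) (beta z).
pose bad l k : set T :=
  if (k <= i)%N then [set w | th_hat l w <= f l k]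
  else [set w | g l k < th_hat l w].
have mth l : measurable_fun setT (th_hat l) by exact: measurable_theta_hat.
have mbad l k : measurable (bad l k).
  rewrite /bad; case: ifP => _;
    [exact: measurable_sublevel|exact: measurable_superlevel].
(* By [decision_wrong], a wrong acceptance at stage l lies in some [bad l k]. Both indices are
   shifted by one, since the unions start at 0. *)
apply: (@le_trans _ _ (P (\big[setU/set0]_(k < m.-1)
    \big[setU/set0]_(l < s z) bad l.+1 k.+1))).
  apply: le_measure; rewrite ?inE.
  - exact: measurable_reject.
  - by apply: bigsetU_measurable => k _; apply: bigsetU_measurable => l _.
  move=> w [j /= /andP[jm ji] [l [/andP[l1 ls] _ Dl]]].
  have [k /andP[k1 km] bk] := decision_wrong hm im jm ji Dl.
  rewrite -(bigcup_mkord m.-1 (fun k => \big[setU/set0]_(l < s z) bad l.+1 k.+1)).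
  exists k.-1; first by rewrite /=; lia.
  rewrite -(bigcup_mkord (s z) (fun l => bad l.+1 k.-1.+1)).
  exists l.-1; first by rewrite /=; lia.
  by rewrite !prednK//; move: bk; rewrite /bad; case: ifP.
apply: (@le_trans _ _ (\sum_(k < m.-1) \sum_(l < s z) P (bad l.+1 k.+1))%E).
  apply: le_trans (@Boole_inequality _ _ _ P
    (fun k => \big[setU/set0]_(l < s z) bad l.+1 k.+1) m.-1 _) _.
    by move=> k _; apply: bigsetU_measurable => l _.
  apply: lee_sum => k _.
  exact: (@Boole_inequality _ _ _ P (fun l => bad l.+1 k.+1)).
apply: (@le_trans _ _ (\sum_(k < m.-1) (delta i / m%:R)%:E)%E).
  apply: lee_sum => k _.
  have km : (k.+1 < m)%N by have := ltn_ord k; lia.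
  have [t1_gt0 t12] := th12 k.+1 km.
  have [slo shi] := sums (Ordinal im, Ordinal km) isT.
  have [ki|ik] := leqP k.+1 i.
    apply: le_trans slo; apply: lee_sum => l _; rewrite /bad ki.
    exact: (theta_hat_le_prob sX0 sY0 normX normY indep _ _ _ _
      (lt_trans t1_gt0 t12) (lo k.+1 isT ki)).
  apply: le_trans shi; apply: lee_sum => l _; rewrite /bad leqNgt ik/=.
  exact: (theta_hat_gt_prob sX0 sY0 normX normY indep _ _ _ _
    t1_gt0 (hi k.+1 ik km)).
(* There are m - 1 thresholds, each costing at most delta_i / m. *)
rewrite sumEFin lee_fin sumr_const card_ord -[_ *+ _]mulr_natr mulrAC ler_pdivrMr//.
by rewrite ler_wpM2l ?ler_nat ?leq_pred// ltW// (andP (hdelta _ im)).1.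
Qed.
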